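(* Let $\{X(t)\in\mathbb{R}^d: t\ge 0\}$ be a stationary, ergodic process with law $\mathbb{P}^*$ for each $X(t)$, such that $\mathbb{E}_{\mathbb{P}^*}\|X(t)\|_2^4<\infty$, each $X(t)$ has a density, and the following central limit property holds: for every measurable $g:\mathbb{R}^d\to\mathbb{R}^{d\times d}$ with $\sum_{i,j}|g(x)_{ij}|\le c(1+\|x\|_2^2)$ for some $c>0$, the limit $\Upsilon_g:=\lim_{n\to\infty}\mathrm{cov}_{\mathbb{P}^*}\big(n^{-1/2}\sum_{t=1}^n g(X(t))\big)$ exists and $n^{1/2}\big[\mathbb{E}_{\mathbb{P}_n}g(X)-\mathbb{E}_{\mathbb{P}^*}g(X)\big]\Rightarrow N(0,\Upsilon_g)$ as $n\to\infty$ with $d$ fixed, where $\mathbb{P}_n=\frac1n\sum_{t=1}^n\delta_{X(t)}$. Let $\boldsymbol{\Sigma}_*:=\mathbb{E}_{\mathbb{P}^*}[XX^\top]$ and assume it is invertible. Assume that the problem $$\min_{\mathbf{H}\in\mathbb{R}^{d\times d}}\ \mathbb{E}_{\mathbb{P}^*}[X^\top\mathbf{H}\mathbf{H}^\top X]\quad\text{s.t. }\mathrm{diag}(\mathbf{H})=1$$ has a unique solution $\mathbf{H}^*$. Then, with $g(x):=xx^\top$, $$n\,\mathcal{R}_n(\mathbf{H}^* )\ \lesssim_D\ \bar{\mathcal{R}}:=\sum_{i=1}^d\frac14\,Z_{\cdot i}^\top\boldsymbol{\Sigma}_*^{-1}Z_{\cdot i},$$ where $Z_{\cdot i}$ is the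 $i$-th column of a random matrix $\mathbf{Z}\sim N(0,\Upsilon_g)$.
   Context: Optimal transport cost: for Borel probability measures $\mathbb{P},\mathbb{Q}$ on $\mathbb{R}^d$, $\mathcal{D}_c(\mathbb{P},\mathbb{Q})=\inf\{\mathbb{E}_\pi\|W-U\|_2^2:\ \pi\text{ a coupling with marginals }\pi_U=\mathbb{P},\pi_W=\mathbb{Q}\}$. The Robust Wasserstein Profile function is, for $\mathbf{H}=(h_{ij})\in\mathbb{R}^{d\times d}$, $$\mathcal{R}_n(\mathbf{H}):=\inf\Big\{\mathcal{D}_c(\mathbb{P},\mathbb{P}_n):\ 1-h_{ii}=0\ (i\in[d]),\ \big(\mathbb{E}_{\mathbb{P}}[XX^\top]\mathbf{H}\big)_{ij}=0\ \text{for } i,j\in[d],\ i\neq j\Big\}.$$ For a random matrix $\mathbf{M}\in\mathbb{R}^{d\times d}$, $\mathrm{cov}(\mathbf{M})$ is the $(d\times d)\times(d\times d)$ tensor with entries $\mathrm{cov}(M_{ij},M_{kl})$; $N(0,\Upsilon)$ denotes a random $d\times d$ matrix $\mathbf{Z}$ with jointly Gaussian entries, $\mathbb{E}Z_{ij}=0$, $\mathrm{cov}(Z_{ij},Z_{kl})=\Upsilon_{ij,kl}$. ''$\Rightarrow$'' denotes weak convergence. The asymptotic stochastic upper bound $n\mathcal{R}_n(\mathbf{H}^* )\lesssim_D\bar{\mathcal{R}}$ means: for every continuous, bounded, non-decreasing $f:\mathbb{R}\to\mathbb{R}$, $\limsup_{n\to\infty}\mathbb{E}[f(n\mathcal{R}_n(\mathbf{H}^*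 ))]\le\mathbb{E}[f(\bar{\mathcal{R}})]$. *)

(* Defs.v *)
From HB Require Import structures.
From mathcomp Require Import all_boot all_order all_algebra.
From mathcomp Require Import all_classical all_reals all_analysis.
Set Implicit Arguments. Unset Strict Implicit. Unset Printing Implicit Defensive.
Import Order.TTheory GRing.Theory Num.Theory.
Import numFieldNormedType.Exports.
Local Open Scope classical_set_scope.
Local Open Scope ring_scope.

Section defs.
Context {R : realType} {d : nat}.

(* R^d, with its (product = Borel) sigma-algebra from mathcomp-analysis *)
Definition Vec := (d.-tuple R).

Definition sqnorm (x : Vec) : R := \sum_(i < d) tnth x i ^+ 2.
Definition sqdist (x y : Vec) : R := \sum_(i < d) (tnth x i - tnth y i) ^+ 2.

Definition outer (x : Vec) : 'M[R]_d := \matrix_(i, j) (tnth x i * tnth x j).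
Definition colv (x : Vec) : 'cV[R]_d := \col_i tnth x i.

Definition Emat (mu : set Vec -> \bar R) (g : Vec -> 'M[R]_d) : 'M[R]_d :=
  \matrix_(i, j) fine (\int[mu]_x (g x i j)%:E)%E.

Definition second_moment_finite (mu : set Vec -> \bar R) : Prop :=
  (\int[mu]_x (sqnorm x)%:E < +oo)%E.

Definition coupling (mu nu : set Vec -> \bar R)
    (pi : probability (Vec * Vec)%type R) : Prop :=
  forall A : set Vec, measurable A ->
    pi (A `*` setT) = mu A /\ pi (setT `*` A) = nu A.

Definition OTcost (mu nu : set Vec -> \bar R) : \bar R :=
  ereal_inf [set (\int[pi]_z (sqdist z.2 z.1)%:E)%E | pi in coupling mu nu].

Definition empirical {dO} {Omega : measurableType dO}
    (X : R -> Omega -> Vec) (n : nat) (w : Omega) : set Vec -> \bar R :=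
  fun A => (n%:R^-1 * \sum_(1 <= t < n.+1) \1_A (X t%:R w))%:E.

Definition RWP (Pn : set Vec -> \bar R) (H : 'M[R]_d) : \bar R :=
  ereal_inf [set OTcost mu Pn | mu in
    [set mu : probability Vec R | second_moment_finite mu /\
       (forall i, 1 - H i i = 0) /\
       (forall i j, i != j -> (Emat mu outer *m H) i j = 0)]].

(* Lebesgue integral over R^d of a nonnegative function (iterated, Tonelli) *)
Fixpoint lebint (n : nat) : (n.-tuple R -> \bar R) -> \bar R :=
  match n with
  | 0 => fun f => f [tuple]
  | n'.+1 => fun f =>
      (\int[@lebesgue_measure R]_x lebint (fun t : n'.-tuple R => f (cons_tuple x t)))%E
  end.

Definition has_density (mu : set Vec -> \bar R) : Prop :=
  exists p : Vec -> R, measurable_fun setT p /\ (forall x, 0 <= p x) /\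
    forall A : set Vec, measurable A ->
      mu A = lebint (fun x => (\1_A x * p x)%:E).

Definition objective (mu : set Vec -> \bar R) (H : 'M[R]_d) : \bar R :=
  (\int[mu]_x (((colv x)^T *m H *m H^T *m colv x) 0 0)%:E)%E.

(* Z : Omega' -> 'M_d is jointly Gaussian N(0, Ups):
   every linear combination sum_ij A_ij Z_ij is N(0, sum A_ij A_kl Ups_ij,kl)
   (a degenerate normal, i.e. the Dirac mass at 0, when the variance is 0) *)
Definition gaussian_mx {dO'} {Omega' : measurableType dO'}
    (Q : probability Omega' R) (Z : Omega' -> 'M[R]_d)
    (Ups : 'I_d -> 'I_d -> 'I_d -> 'I_d -> R) : Prop :=
  (forall i j, measurable_fun setT (fun w => Z w i j)) /\
  forall A : 'M[R]_d,
    let v := \sum_(i < d) \sum_(j < d) \sum_(k < d) \sum_(l < d)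
               A i j * A k l * Ups i j k l in
    0 <= v /\
    forall B : set R, measurable B ->
      Q ((fun w => \sum_(i < d) \sum_(j < d) A i j * Z w i j) @^-1` B) =
      (if v == 0 then ((0:R) \in B)%:R%:E else normal_prob 0 (Num.sqrt v) B).

Definition scaled_sum {dO} {Omega : measurableType dO}
    (X : R -> Omega -> Vec) (g : Vec -> 'M[R]_d) (n : nat) (w : Omega) : 'M[R]_d :=
  (Num.sqrt (n%:R))^-1 *: \sum_(1 <= t < n.+1) g (X t%:R w).

Definition cov_limit {dO} {Omega : measurableType dO} (P : probability Omega R)
    (X : R -> Omega -> Vec) (g : Vec -> 'M[R]_d)
    (Ups : 'I_d -> 'I_d -> 'I_d -> 'I_d -> R) : Prop :=
  forall i j k l,
    (fun n : nat => covariance P (fun w => scaled_sum X g n w i j)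
                                 (fun w => scaled_sum X g n w k l))
      @ \oo --> (Ups i j k l)%:E.

Definition weak_cvg_gaussian {dO} {Omega : measurableType dO} (P : probability Omega R)
    (Y : nat -> Omega -> 'M[R]_d) (Ups : 'I_d -> 'I_d -> 'I_d -> 'I_d -> R) : Prop :=
  forall dO' (Omega' : measurableType dO') (Q : probability Omega' R)
         (Z : Omega' -> 'M[R]_d), gaussian_mx Q Z Ups ->
  forall F : 'M[R]_d -> R, continuous F -> (exists M, forall m, `|F m| <= M) ->
    (fun n : nat => (\int[P]_w (F (Y n w))%:E)%E) @ \oo
       --> (\int[Q]_w (F (Z w))%:E)%E.

Definition clt_property {dO} {Omega : measurableType dO} (P : probability Omega R)
    (X : R -> Omega -> Vec) (Pstar : probability Vec R) : Prop :=
  forall (g : Vec -> 'M[R]_d) (c : R),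
    (forall i j, measurable_fun setT (fun x => g x i j)) -> 0 < c ->
    (forall x, \sum_(i < d) \sum_(j < d) `|g x i j| <= c * (1 + sqnorm x)) ->
    exists Ups, cov_limit P X g Ups /\
      weak_cvg_gaussian P
        (fun n w => Num.sqrt (n%:R) *:
           ((n%:R)^-1 *: \sum_(1 <= t < n.+1) g (X t%:R w) - Emat Pstar g)) Ups.

Definition stationary {dO} {Omega : measurableType dO} (P : probability Omega R)
    (X : R -> Omega -> Vec) : Prop :=
  forall (k : nat) (ts : 'I_k -> R) (s : R),
    (forall i, 0 <= ts i) -> 0 <= s ->
    forall A : set (k.-tuple Vec), measurable A ->
      P ((fun w => [tuple X (ts i + s) w | i < k]) @^-1` A) =
      P ((fun w => [tuple X (ts i) w | i < k]) @^-1` A).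

Definition cylinders : set (set (R -> Vec)) :=
  [set B | exists t (A : set Vec), 0 <= t /\ measurable A /\
             B = (fun x : R -> Vec => x t) @^-1` A].

Definition path_shift (s : R) (x : R -> Vec) : R -> Vec := fun t => x (t + s).

Definition ergodic {dO} {Omega : measurableType dO} (P : probability Omega R)
    (X : R -> Omega -> Vec) : Prop :=
  forall B : set (R -> Vec), <<s cylinders >> B ->
    (forall s, 0 <= s -> path_shift s @^-1` B = B) ->
    P ((fun w => fun t => X t w) @^-1` B) = 0%E \/
    P ((fun w => fun t => X t w) @^-1` B) = 1%E.

Definition Rbar (Sigma : 'M[R]_d) (Z : 'M[R]_d) : R :=
  \sum_(i < d) 4^-1 * (((col i Z)^T *m invmx Sigma *m col i Z) 0 0).

End defs.

(* Main.v *)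
(* Optimality of [Hstar] makes [Sigma *m Hstar] diagonal, where [Sigma] is the
   second moment of [Pstar], so every law with second moment [Sigma] is feasible
   for the profile function. Let [S = Sigma_n - Sigma] be the error of the
   empirical second moment, of order [n^(-1/2)] with [sqrt n S] converging to a
   Gaussian [Z]. For small [S] the equation [2 M + M Sigma^-1 M = S] has a
   symmetric solution [M = S/2 + O(|S|^2)], and [G = 1 + M Sigma^-1] satisfies
   [G Sigma G^T = Sigma_n]. Hence transporting each sample point by [G^-1]
   reaches the second moment [Sigma] exactly, at cost
   [tr (M Sigma^-1 M) = tr (S Sigma^-1 S) / 4 + O(|S|^3)]; after multiplication
   by [n] this is [Rbar] at [sqrt n S], up to [O(n^(-1/2))] on bounded sets. *)
Require Import Defs.
From HB Require Import structures.
From mathcomp Require Import all_boot all_order all_algebra.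
From mathcomp Require Import all_classical all_reals all_analysis.
From mathcomp Require Import measurable_realfun ring lra.
Set Implicit Arguments.
Unset Strict Implicit.
Unset Printing Implicit Defensive.
Import Order.TTheory GRing.Theory Num.Theory.
Import numFieldNormedType.Exports.
Local Open Scope classical_set_scope.
Local Open Scope ring_scope.

(* The library has the norm and the completeness of matrices, but not their join. *)
HB.instance Definition _ (R : realType) (m n : nat) :=
  Uniform_isComplete.Build 'M[R]_(m, n) cauchy_cvg.

(** * Norm estimates for matrices *)

Lemma mx_entry_norm_le (R : realType) (m n : nat) (A : 'M[R]_(m, n)) i j :
  `|A i j| <= `|A|.
Proof.
rewrite [leRHS]/Num.Def.normr/= mx_normrE.
exact: (le_bigmax _ (fun ij => `|A ij.1 ij.2|) (i, j)).
Qed.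

Lemma mx_norm_leP (R : realType) (m n : nat) (A : 'M[R]_(m, n)) c :
  0 <= c -> (forall i j, `|A i j| <= c) -> `|A| <= c.
Proof.
move=> c0 Ac; rewrite [leLHS]/Num.Def.normr/= mx_normrE.
by apply: bigmax_le => // -[i j] _; exact: Ac.
Qed.

Lemma mulmx_norm_le (R : realType) (m n p : nat) (A : 'M[R]_(m, n))
  (B : 'M[R]_(n, p)) : `|A *m B| <= n%:R * `|A| * `|B|.
Proof.
apply: mx_norm_leP => [|i j]; first by rewrite !mulr_ge0.
rewrite mxE (le_trans (ler_norm_sum _ _ _))//.
apply: (@le_trans _ _ (\sum_(k < n) `|A| * `|B|)).
  by apply: ler_sum => k _; rewrite normrM ler_pM ?mx_entry_norm_le.
by rewrite sumr_const card_ord -[leLHS]mulr_natl mulrA.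
Qed.

Lemma trmx_norm (R : realType) (m n : nat) (A : 'M[R]_(m, n)) : `|A^T| = `|A|.
Proof.
apply/eqP; rewrite eq_le; apply/andP; split; apply: mx_norm_leP => // i j.
  by rewrite mxE mx_entry_norm_le.
by have := mx_entry_norm_le A^T j i; rewrite mxE.
Qed.

Lemma mxtrace_norm_le (R : realType) (n : nat) (A : 'M[R]_n) :
  `|\tr A| <= n%:R * `|A|.
Proof.
rewrite (le_trans (ler_norm_sum _ _ _))//.
apply: (@le_trans _ _ (\sum_(k < n) `|A|)).
  by apply: ler_sum => k _; exact: mx_entry_norm_le.
by rewrite sumr_const card_ord -[leLHS]mulr_natl.
Qed.

(** A row [v] killed by [1%:M + N] equals [- (v *m N)], so its norm is at most itself times a factor
    below 1, which forces [v = 0]. *)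
Lemma unitmx_add1 (R : realType) (n : nat) (N : 'M[R]_n) :
  n%:R * `|N| < 1 -> 1%:M + N \in unitmx.
Proof.
move=> N1; rewrite -row_free_unit; apply: inj_row_free => v.
rewrite mulmxDr mulmx1 => /eqP; rewrite addr_eq0 => /eqP vN.
have : `|v| <= `|v| * (n%:R * `|N|).
  by rewrite {1}vN normrN (le_trans (mulmx_norm_le _ _))// [leRHS]mulrCA mulrA.
apply: contraTeq; rewrite -normr_gt0 => v0.
by rewrite ler_pMr// -ltNge.
Qed.

(** * The quadratic matrix equation *)

(** The two products account for [n%:R ^+ 2]; the extra 1 keeps the constant at least 1 even when
    [V] vanishes. *)
Lemma mulmx3_norm_le (R : realType) (n : nat) (A V B : 'M[R]_n) :
  `|A *m V *m B^T| <= (1 + n%:R ^+ 2 * `|V|) * `|A| * `|B|.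
Proof.
rewrite (le_trans (mulmx_norm_le _ _))// trmx_norm.
apply: (@le_trans _ _ (n%:R * (n%:R * `|A| * `|V|) * `|B|)).
  by rewrite ler_wpM2r// ler_wpM2l// mulmx_norm_le.
rewrite ler_wpM2r//.
rewrite (_ : n%:R * _ = n%:R ^+ 2 * `|V| * `|A|); last by ring.
by rewrite ler_wpM2r// lerDr.
Qed.

(* A fixed point of [M |-> (S - M V M^T) / 2] is automatically symmetric, since every value of this map is. *)
Lemma quadratic_mx_eq_solvable (R : realType) (n : nat) (V S : 'M[R]_n)
    (c := 1 + n%:R ^+ 2 * `|V|) :
  V^T = V -> S^T = S -> 2 * c * `|S| <= 1 ->
  exists M : 'M[R]_n, [/\ M^T = M, `|M| <= `|S| & M + M + M *m V *m M^T = S].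
Proof.
move=> Vs Ss cS.
have c1 : 1 <= c by rewrite lerDl mulr_ge0// exprn_ge0.
have c0 : 0 <= c by apply: le_trans c1.
have h0 : 0 <= 2^-1 :> R by [].
pose phi (M : 'M[R]_n) := 2^-1 *: (S - M *m V *m M^T).
have symphi M : (phi M)^T = phi M.
  by rewrite /phi linearZ/= linearB/= Ss !trmx_mul trmxK Vs mulmxA.
suff [M MS Mphi] : exists2 M, `|M| <= `|S| & M = phi M.
  exists M; split => //; first by rewrite Mphi symphi.
  rewrite -mulr2n -scaler_nat {1}Mphi /phi scalerA mulfV// scale1r.
  by rewrite subrK.
have [S0|Spos] := eqVneq S 0.
  by exists 0; rewrite ?normr0// /phi S0 !mul0mx subr0 scaler0.
have {}Spos : 0 < `|S| by rewrite normr_gt0.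
pose U : set 'M[R]_n := closed_ball_ Num.Def.normr 0 `|S|.
have UE M : U M <-> `|M| <= `|S| by rewrite /U /closed_ball_/= sub0r normrN.
have phiU : {homo phi : M / U M >-> U M}.
  move=> M /UE MS; apply/UE; rewrite /phi normrZ ger0_norm//.
  rewrite ler_pdivrMl// (le_trans (ler_normB _ _))//.
  have : `|M *m V *m M^T| <= `|S|.
    rewrite (le_trans (mulmx3_norm_le _ _ _))// -/c.
    apply: (@le_trans _ _ (c * `|S| * `|S|)).
      by rewrite ler_pM ?mulr_ge0// ler_wpM2l.
    by rewrite -{3}[`|S|]mul1r ler_wpM2r// (le_trans _ cS)// ler_wpM2r// ler_peMl// ler1n.
  lra.
have [] := @banach_fixed_point R 'M[R]_n U (mkfun_fun phiU).
(* The difference of the quadratic terms splits into two parts, each at most [c] times the norm of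
   [S] times the distance; [2 * c] times the norm of [S] is at most 1, and the factor [2^-1] in
   [phi] remains as contraction ratio. *)
- exists 2^-1%:nng; split => /=; first by rewrite invf_lt1// ltr1n.
  move=> -[M N] [/UE/= MS /UE/= NS].
  rewrite /mkfun /phi -scalerBr normrZ ger0_norm// ler_wpM2l//.
  rewrite /= (_ : S - _ - (S - _) = N *m V *m N^T - M *m V *m M^T); last by rewrite opprB addrC addrA subrK.
  rewrite (_ : _ - _ = N *m V *m (N - M)^T + (N - M) *m V *m M^T); last first.
    by rewrite linearB/= mulmxBr !mulmxBl addrA subrK.
  rewrite (le_trans (ler_normD _ _))//.
  rewrite -[`|M - N|]normrN opprB.
  apply: (@le_trans _ _ (c * `|S| * `|N - M| + c * `|S| * `|N - M|)); last first.
    by rewrite -mulrDl -mulr2n -mulr_natl mulrA -[leRHS]mul1r ler_wpM2r.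
  apply: lerD; first rewrite (le_trans (mulmx3_norm_le _ _ _))// -/c.
    by rewrite ler_wpM2r// ler_wpM2l.
  rewrite (le_trans (mulmx3_norm_le _ _ _))// -/c [leRHS]mulrAC.
  by rewrite ler_wpM2l// mulr_ge0.
- exact: closed_closed_ball_.
- by exists 0; apply/UE; rewrite normr0.
- by move=> M /UE MS MM; exists M.
Qed.

(** With [W] the quadratic term, [M + M = S - W]; hence [4 *: W], which is
    [(M + M) *m V *m (M + M)^T], differs from [S *m V *m S^T] only by terms of third order. *)
Lemma quadratic_mx_eq_trace (R : realType) (n : nat) (V S M : 'M[R]_n)
    (c := 1 + n%:R ^+ 2 * `|V|) :
  V^T = V -> S^T = S -> M^T = M -> `|M| <= `|S| -> M + M + M *m V *m M^T = S ->
  \tr (M *m V *m M^T) <= 4^-1 * \tr (S *m V *m S^T) + n%:R * c ^+ 2 * `|S| ^+ 3.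
Proof.
move=> Vs Ss Ms MS ME.
have c1 : 1 <= c by rewrite lerDl mulr_ge0// exprn_ge0.
have c0 : 0 <= c by apply: le_trans c1.
set W := M *m V *m M^T in ME *.
have WS : `|W| <= c * `|S| ^+ 2.
  rewrite (le_trans (mulmx3_norm_le _ _ _))// -/c expr2 mulrA.
  by rewrite ler_pM ?mulr_ge0// ler_wpM2l.
have Wsym : W^T = W by rewrite /W !trmx_mul trmxK Vs mulmxA.
have SE : 4 *: W = S *m V *m S^T - (S *m V *m W^T + W *m V *m (M + M)^T).
  have MMS : M + M = S - W by rewrite -ME addrK.
  have -> : 4 *: W = (M + M) *m V *m (M + M)^T.
    rewrite linearD/= mulmxDr !mulmxDl -/W -!mulr2n -mulrnA.
    by rewrite scaler_nat.
  rewrite {1}MMS !mulmxBl opprD addrA; congr (_ - _).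
  by rewrite {1}MMS linearB/= mulmxBr.
have -> : W = 4^-1 *: (S *m V *m S^T) - 4^-1 *: (S *m V *m W^T + W *m V *m (M + M)^T).
  by rewrite -scalerBr -SE scalerA mulVf// scale1r.
rewrite raddfB/= !mxtraceZ lerD2l -mulrN.
(* The two error terms contribute 1 and 2 to the factor 3; the resulting [3 / 4] is then rounded up
   to 1. *)
apply: (@le_trans _ _ (4^-1 * (n%:R * (3 * c ^+ 2 * `|S| ^+ 3)))).
  rewrite ler_wpM2l// (le_trans (ler_norm _))// normrN.
  rewrite (le_trans (mxtrace_norm_le _))// ler_wpM2l//.
  rewrite (le_trans (ler_normD _ _))//.
  apply: (@le_trans _ _ (c * `|S| * (c * `|S| ^+ 2) + c * (c * `|S| ^+ 2) * (2 * `|S|))).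
    apply: lerD; rewrite (le_trans (mulmx3_norm_le _ _ _))// -/c.
      by rewrite ler_wpM2l// mulr_ge0.
    rewrite ler_pM// ?mulr_ge0//; first by rewrite ler_wpM2l.
    by rewrite (le_trans (ler_normD _ _))// mulr2n mulrDl mul1r lerD.
  by rewrite le_eqVlt; apply/orP; left; apply/eqP; ring.
rewrite (_ : 4^-1 * _ = (3 / 4) * (n%:R * c ^+ 2 * `|S| ^+ 3)); last by field.
rewrite ler_piMl ?mulr_ge0 ?exprn_ge0//.
lra.
Qed.

(** * Uniform measures on finitely many points *)

(* There are [n.+1] points: [p 0], ..., [p n]. *)
Definition uniform_on (R : realType) (dT : measure_display)
    (T : measurableType dT) (p : nat -> T) (n : nat) : set T -> \bar R :=
  msum (fun k => mscale (n.+1%:R^-1)%:nng \d_(p k)) n.+1.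

HB.instance Definition _ (R : realType) (dT : measure_display)
    (T : measurableType dT) (p : nat -> T) (n : nat) :=
  Measure.on (@uniform_on R dT T p n).

Lemma uniform_onE (R : realType) (dT : measure_display)
    (T : measurableType dT) (p : nat -> T) (n : nat) (A : set T) :
  uniform_on R p n A = (n.+1%:R^-1 * \sum_(k < n.+1) \1_A (p k))%:E.
Proof.
rewrite /uniform_on /msum/= /mscale/= mulr_sumr -sumEFin.
by apply: eq_bigr => k _.
Qed.

Lemma uniform_on_setT (R : realType) (dT : measure_display)
    (T : measurableType dT) (p : nat -> T) (n : nat) :
  uniform_on R p n setT = 1%E.
Proof.
rewrite uniform_onE; under eq_bigr do rewrite indicT.
by rewrite sumr_const card_ord mulVf.
Qed.

HB.instance Definition _ (R : realType) (dT : measure_display)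
    (T : measurableType dT) (p : nat -> T) (n : nat) :=
  Measure_isProbability.Build dT T R (@uniform_on R dT T p n)
    (@uniform_on_setT R dT T p n).

Lemma ge0_integral_uniform_on (R : realType) (dT : measure_display)
    (T : measurableType dT) (p : nat -> T) (n : nat) (f : T -> \bar R) :
  measurable_fun setT f -> (forall x, 0 <= f x)%E ->
  (\int[uniform_on R p n]_x f x =
   \sum_(k < n.+1) (n.+1%:R^-1)%:E * f (p k))%E.
Proof.
move=> mf f0; rewrite ge0_integral_measure_sum//; apply: eq_bigr => k _.
by rewrite ge0_integral_mscale//= integral_dirac//= diracT mul1e.
Qed.

Lemma integral_uniform_on (R : realType) (dT : measure_display)
    (T : measurableType dT) (p : nat -> T) (n : nat) (f : T -> R) :
  measurable_fun setT f ->
  (\int[uniform_on R p n]_x (f x)%:E)%E =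
  (n.+1%:R^-1 * \sum_(k < n.+1) f (p k))%:E.
Proof.
move=> mf; rewrite integralE (_ : (fun x => (f x)%:E) = EFin \o f)//.
rewrite funerpos funerneg !ge0_integral_uniform_on//=.
- rewrite !sumEFin -EFinB -sumrB mulr_sumr; congr _%:E; apply: eq_bigr => k _.
  by rewrite -mulrBr -[in RHS](funrposBneg f).
- by apply/measurable_EFinP; exact: measurable_funrneg.
- by move=> x; rewrite lee_fin funrneg_ge0.
- by apply/measurable_EFinP; exact: measurable_funrpos.
- by move=> x; rewrite lee_fin funrpos_ge0.
Qed.

(** Sample times start at 1, whence the shift of index; size 0 is excluded, as [empirical] then has
    mass 0. *)
Lemma empirical_uniform_on (R : realType) (d : nat) (dO : measure_display)
    (Omega : measurableType dO) (X : R -> Omega -> @Vec R d) (n : nat) w A :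
  empirical X n.+1 w A = uniform_on R (fun k => X k.+1%:R w) n A.
Proof.
by rewrite uniform_onE /empirical big_add1/= big_mkord.
Qed.

(** * Outer products and distances in coordinates *)

Lemma measurable_outer (R : realType) (d : nat) (i j : 'I_d) :
  measurable_fun setT (fun x : @Vec R d => outer x i j).
Proof.
rewrite (_ : (fun x => _) = (fun x => tnth x i * tnth x j)).
  by apply: measurable_funM; exact: measurable_tnth.
by apply/funext => x; rewrite mxE.
Qed.

Lemma measurable_sqnorm (R : realType) (d : nat) :
  measurable_fun setT (fun x : @Vec R d => sqnorm x).
Proof.
by apply: measurable_sum => i; apply: measurable_funX; exact: measurable_tnth.
Qed.

Lemma measurable_sqdist (R : realType) (d : nat) :
  measurable_fun setT (fun z : @Vec R d * @Vec R d => sqdist z.2 z.1).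
Proof.
apply: measurable_sum => i; apply: measurable_funX; apply: measurable_funB.
  exact: (measurableT_comp (@measurable_tnth _ R d i) measurable_snd).
exact: (measurableT_comp (@measurable_tnth _ R d i) measurable_fst).
Qed.

Lemma outerE (R : realType) (d : nat) (x : @Vec R d) :
  outer x = colv x *m (colv x)^T.
Proof. by apply/matrixP => i j; rewrite !mxE big_ord1 !mxE. Qed.

Lemma sqdistE (R : realType) (d : nat) (x y : @Vec R d) :
  sqdist x y = \tr ((colv x - colv y) *m (colv x - colv y)^T).
Proof.
by apply: eq_bigr => i _; rewrite !mxE big_ord1 !mxE expr2.
Qed.

Definition vec_of (R : realType) (d : nat) (u : 'cV[R]_d) : @Vec R d :=
  [tuple u i 0 | i < d].

Lemma colv_vec_of (R : realType) (d : nat) (u : 'cV[R]_d) :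
  colv (vec_of u) = u.
Proof. by apply/matrixP => i j; rewrite !mxE tnth_mktuple ord1. Qed.

(** * Transport of the sample points *)

Lemma Emat_uniform_on (R : realType) (d : nat) (p : nat -> @Vec R d) n :
  Emat (uniform_on R p n) outer =
  n.+1%:R^-1 *: \sum_(k < n.+1) outer (p k).
Proof.
apply/matrixP => i j; rewrite !mxE integral_uniform_on//=.
  by rewrite summxE.
exact: measurable_outer.
Qed.

(* Moving each sample point [x] to [G^-1 x] is a coupling whose first marginal is feasible. *)
Lemma RWP_uniform_on_le (R : realType) (d : nat) (p : nat -> @Vec R d) n
    (Pn : set (@Vec R d) -> \bar R) (H Sigma G : 'M[R]_d) :
  (forall A, Pn A = uniform_on R p n A) ->
  (forall i, H i i = 1) -> (forall i j, i != j -> (Sigma *m H) i j = 0) ->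
  G \in unitmx ->
  n.+1%:R^-1 *: (\sum_(k < n.+1) outer (p k)) = G *m Sigma *m G^T ->
  (RWP Pn H <= (\tr ((G - 1%:M) *m Sigma *m (G - 1%:M)^T))%:E)%E.
Proof.
move=> PnE H1 SH uG SE.
pose q k := vec_of (invmx G *m colv (p k)).
have qE k : colv (q k) = invmx G *m colv (p k) by exact: colv_vec_of.
have ESigma : Emat (uniform_on R q n) outer = Sigma.
  rewrite Emat_uniform_on.
  transitivity (invmx G *m (G *m Sigma *m G^T) *m (invmx G)^T).
    rewrite -SE -scalemxAr -scalemxAl mulmx_sumr mulmx_suml.
    by congr (_ *: _); apply: eq_bigr => k _; rewrite !outerE qE trmx_mul !mulmxA.
  by rewrite -!mulmxA -trmx_mul mulVmx// trmx1 mulmx1 mulKmx.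
apply: (@le_trans _ _ (OTcost (uniform_on R q n) Pn)).
  apply: ereal_inf_lbound; exists (uniform_on R q n) => //; split.
    rewrite /second_moment_finite integral_uniform_on ?ltry//.
    exact: measurable_sqnorm.
  split; first by move=> i; rewrite H1 subrr.
  by rewrite ESigma.
apply: (@le_trans _ _ (\int[uniform_on R (fun k => (q k, p k)) n]_z (sqdist z.2 z.1)%:E)%E).
  apply: ereal_inf_lbound; exists (uniform_on R (fun k => (q k, p k)) n) => //.
  move=> A mA; rewrite PnE !uniform_onE.
  by split; rewrite [LHS]uniform_onE; congr (_ * _)%:E; apply: eq_bigr => k _;
    rewrite !indicE in_setX in_setT ?andbT.
rewrite integral_uniform_on; last exact: measurable_sqdist.
rewrite lee_fin le_eqVlt; apply/orP; left; apply/eqP => /=.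
transitivity (\tr ((1%:M - invmx G) *m (G *m Sigma *m G^T) *m (1%:M - invmx G)^T)).
  rewrite -SE -scalemxAr -scalemxAl mxtraceZ mulmx_sumr mulmx_suml raddf_sum/=.
  congr (_ * _); apply: eq_bigr => k _.
  rewrite sqdistE qE -[X in X - _]mul1mx -mulmxBl outerE.
  by rewrite [in LHS]trmx_mul !mulmxA.
(* Absorbing the outer factors [G] into the displacement turns the sample second moment back into
   [Sigma]. *)
have GE : (1%:M - invmx G) *m G = G - 1%:M by rewrite mulmxBl mul1mx mulVmx.
by rewrite !mulmxA GE -!mulmxA -trmx_mul GE.
Qed.

(** With a finite upper bound, this makes the profile a finite number, so that [fine] does not fall
    back to 0. *)
Lemma RWP_ge0 (R : realType) (d : nat) (Pn : set (@Vec R d) -> \bar R)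
  (H : 'M[R]_d) : (0 <= RWP Pn H)%E.
Proof.
apply: le_ereal_inf_tmp => _ [mu _ <-]; apply: le_ereal_inf_tmp => _ [pi _ <-].
apply: integral_ge0 => z _; rewrite lee_fin.
by apply: sumr_ge0 => i _; rewrite sqr_ge0.
Qed.

(** * Second moments and first-order optimality *)

Lemma Emat_outer_sym (R : realType) (d : nat) (mu : set (@Vec R d) -> \bar R) :
  (Emat mu outer)^T = Emat mu outer.
Proof.
apply/matrixP => i j; rewrite !mxE; congr (fine (integral _ _ _)).
by apply/funext => x; rewrite !mxE mulrC.
Qed.

Lemma sqnorm_ge0 (R : realType) (d : nat) (x : @Vec R d) : 0 <= sqnorm x.
Proof. by apply: sumr_ge0 => i _; rewrite sqr_ge0. Qed.

Lemma outer_le_sqnorm (R : realType) (d : nat) (x : @Vec R d) i j :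
  `|outer x i j| <= sqnorm x.
Proof.
have le_sq k : tnth x k ^+ 2 <= sqnorm x.
  by rewrite /sqnorm (bigD1 k)//= lerDl sumr_ge0// => l _; rewrite sqr_ge0.
have ? := le_sq i; have ? := le_sq j.
rewrite mxE ler_norml; apply/andP; split; nra.
Qed.

Lemma integrable_outer (R : realType) (d : nat) (mu : probability (@Vec R d) R)
    i j : (\int[mu]_x ((sqnorm x) ^+ 2)%:E < +oo)%E ->
  mu.-integrable setT (fun x => (outer x i j)%:E).
Proof.
move=> mu4; apply: (@le_integrable _ _ _ _ _ _ _
    (fun x => (1 + sqnorm x ^+ 2)%:E)) => //.
- by apply/measurable_EFinP; exact: measurable_outer.
- move=> x _ /=; rewrite lee_fin (le_trans (outer_le_sqnorm x i j))//.
  have := sqnorm_ge0 x => x0; rewrite ger0_norm; first by nra.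
  by rewrite addr_ge0// sqr_ge0.
have m2 : measurable_fun setT (fun x : @Vec R d => (sqnorm x ^+ 2)%:E).
  by apply/measurable_EFinP; apply: measurable_funX; exact: measurable_sqnorm.
rewrite (_ : (fun x => _) = cst 1%E \+ (fun x => (sqnorm x ^+ 2)%:E))//.
apply: integrableD => //; first exact: finite_measure_integrable_cst.
apply/integrableP; split => //.
apply: le_lt_trans mu4; rewrite le_eqVlt; apply/orP; left; apply/eqP.
by apply: eq_integral => x _; rewrite gee0_abs// lee_fin sqr_ge0.
Qed.

(** Cyclicity of the trace makes the integrand linear in [outer x]; the fourth moment gives the
    integrability needed to exchange sum and integral. *)
Lemma objectiveE (R : realType) (d : nat) (mu : probability (@Vec R d) R)
    (H : 'M[R]_d) : (\int[mu]_x ((sqnorm x) ^+ 2)%:E < +oo)%E ->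
  objective mu H = (\tr (H *m H^T *m Emat mu outer))%:E.
Proof.
move=> mu4; have iout i j := integrable_outer i j mu4.
have outerT (x : @Vec R d) : (((colv x)^T *m H *m H^T *m colv x) 0 0)%:E =
    (\sum_(i < d) \sum_(j < d) ((H *m H^T) i j)%:E * (outer x j i)%:E)%E.
  rewrite -trace_mx11 -mulmxA -(mulmxA _ H) mxtrace_mulC.

  rewrite -!mulmxA -outerE !mulmxA.
  rewrite /mxtrace -sumEFin.
  by apply: eq_bigr => i _; rewrite mxE -sumEFin.
rewrite /objective; under eq_integral do rewrite outerT.
rewrite integral_sum//; last first.
  by move=> i; apply: integrable_sum => // j _; apply: integrableZl => //.
rewrite /mxtrace -sumEFin; apply: eq_bigr => i _.
rewrite integral_sum//; last by move=> j; apply: integrableZl => //.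
rewrite mxE -sumEFin; apply: eq_bigr => j _.
rewrite integralZl// EFinM; congr (_ * _)%E; rewrite mxE fineK//.
exact: integrable_fin_num.
Qed.

Lemma mxtrace_delta_mul (R : realType) (d : nat) (A : 'M[R]_d) i j :
  \tr (delta_mx i j *m A) = A j i.
Proof.
rewrite /mxtrace (bigD1 i)//= big1 => [|k ki]; last first.
  by rewrite mxE big1// => l _; rewrite mxE (negbTE ki) mul0r.
rewrite addr0 mxE (bigD1 j)//= big1 => [|l lj].
  by rewrite mxE !eqxx mul1r addr0.
by rewrite mxE eqxx (negbTE lj) mul0r.
Qed.

(* First-order optimality along each off-diagonal direction [delta_mx i j]. *)
Lemma objective_min_offdiag (R : realType) (d : nat)
    (mu : probability (@Vec R d) R) (H : 'M[R]_d) :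
  (\int[mu]_x ((sqnorm x) ^+ 2)%:E < +oo)%E ->
  (forall i, H i i = 1) ->
  (forall H' : 'M[R]_d, (forall i, H' i i = 1) ->
     (objective mu H <= objective mu H')%E) ->
  forall i j, i != j -> (Emat mu outer *m H) i j = 0.
Proof.
move=> mu4 H1 Hmin i j ij.
set S := Emat mu outer; have Ssym : S^T = S by exact: Emat_outer_sym.
set b := (S *m H) i j; set D : 'M[R]_d := delta_mx i j.
pose a := \tr (D *m D^T *m S).
have trD : \tr (D *m H^T *m S) = b.
  by rewrite -mulmxA mxtrace_delta_mul -{1}Ssym -trmx_mul mxE.
have trDT : \tr (H *m D^T *m S) = b.
  by rewrite -mxtrace_tr !trmx_mul trmxK Ssym mxtrace_mulC trD.
(* Moving by [t *: D] keeps the diagonal because [i != j]; the right-hand side is the change of the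
   objective. *)
have quad t : 0 <= 2 * t * b + t ^+ 2 * a.
  have HtD k : (H + t *: D) k k = 1.
    rewrite !mxE H1; have [->|_] := eqVneq k i; last by rewrite mulr0 addr0.
    by rewrite (negbTE ij) mulr0 addr0.
  have := Hmin _ HtD; rewrite !objectiveE// -/S lee_fin.
  rewrite linearD/= linearZ/= mulmxDr !mulmxDl -!scalemxAr -!scalemxAl !scalerA.
  rewrite !mxtraceD !mxtraceZ trD trDT -/a => h.
  rewrite -subr_ge0 in h; rewrite (le_trans h)// le_eqVlt; apply/orP; left.
  by apply/eqP; ring.
have a0 : 0 <= a by have := quad 1; have := quad (-1); nra.
have a1 : 0 < a + 1 by rewrite ltr_wpDl.
(* The denominator [a + 1] instead of the minimizing [a] avoids a separate case [a = 0]; the value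
   is still negative unless [b = 0]. *)
have := quad (- b / (a + 1)).
rewrite (_ : _ + _ = - (b ^+ 2 * ((a + 2) / (a + 1) ^+ 2))); last first.
  by field; rewrite gt_eqF.
rewrite oppr_ge0 pmulr_lle0; last by rewrite divr_gt0 ?exprn_gt0// ltr_wpDl.
by move=> b2; apply/eqP; rewrite -sqrf_eq0 eq_le b2 sqr_ge0.
Qed.

(** * Expansion of the scaled profile function *)

Lemma RbarE (R : realType) (d : nat) (Sigma Z : 'M[R]_d) :
  Rbar Sigma Z = 4^-1 * \tr (Z^T *m invmx Sigma *m Z).
Proof.
rewrite /Rbar -mulr_sumr; congr (_ * _); apply: eq_bigr => i _.
rewrite !mxE; apply: eq_bigr => k _; rewrite !mxE; congr (_ * _).
by apply: eq_bigr => l _; rewrite !mxE.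
Qed.

(** The sample error is [Y] divided by the root of the sample size: after scaling, its quadratic
    term becomes the one in [Y] and the cubic remainder keeps one inverse root. The bound on [Y] is
    the smallness that makes the quadratic equation solvable. *)
Lemma scaled_RWP_uniform_on_le (R : realType) (d : nat) (p : nat -> @Vec R d) n
    (Pn : set (@Vec R d) -> \bar R) (H Sigma : 'M[R]_d)
    (c := 1 + d%:R ^+ 2 * `|invmx Sigma|)
    (Y := Num.sqrt n.+1%:R *:
       (n.+1%:R^-1 *: \sum_(k < n.+1) outer (p k) - Sigma)) :
  (forall A, Pn A = uniform_on R p n A) ->
  (forall i, H i i = 1) -> (forall i j, i != j -> (Sigma *m H) i j = 0) ->
  Sigma^T = Sigma -> Sigma \in unitmx ->
  2 * c * `|Y| <= Num.sqrt n.+1%:R ->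
  n.+1%:R * fine (RWP Pn H) <=
    Rbar Sigma Y + d%:R * c ^+ 2 * `|Y| ^+ 3 / Num.sqrt n.+1%:R.
Proof.
move=> PnE H1 SH Ssym uS.
set V := invmx Sigma in c *; set r := Num.sqrt _ in Y *; move=> cY.
have r0 : 0 < r by rewrite sqrtr_gt0.
have rr : n.+1%:R = r ^+ 2 :> R by rewrite sqr_sqrtr.
have Vsym : V^T = V by rewrite /V trmx_inv Ssym.
have VS : V *m Sigma = 1%:M by exact: mulVmx.
have SV : Sigma *m V = 1%:M by exact: mulmxV.
have c1 : 1 <= c by rewrite lerDl mulr_ge0// exprn_ge0.
pose S := n.+1%:R^-1 *: \sum_(k < n.+1) outer (p k) - Sigma.
have outersym (x : @Vec R d) : (outer x)^T = outer x.
  by apply/matrixP => i j; rewrite !mxE mulrC.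
have SSsym : S^T = S.
  rewrite /S linearB/= linearZ/= Ssym raddf_sum/=; congr (_ *: _ - _).
  by apply: eq_bigr => k _.
have YS : Y = r *: S by [].
have nY : `|Y| = r * `|S| by rewrite YS normrZ gtr0_norm.
have cS : 2 * c * `|S| <= 1.
  by move: cY; rewrite nY mulrCA -{2}[r]mulr1 ler_pM2l.
have [M [Msym MS ME]] := quadratic_mx_eq_solvable Vsym SSsym cS.
pose G := 1%:M + M *m V.
have uG : G \in unitmx.
  apply: unitmx_add1; apply: (@le_lt_trans _ _ (c * `|S|)); last by lra.
  apply: (@le_trans _ _ (d%:R * (d%:R * `|M| * `|V|))).
    by rewrite ler_wpM2l// mulmx_norm_le.
  rewrite (_ : _ * _ = d%:R ^+ 2 * `|V| * `|M|); last by ring.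
  by rewrite ler_pM ?mulr_ge0 ?exprn_ge0// lerDr.
(* Since [V] inverts [Sigma], the product expands to [Sigma + (M + M + M *m V *m M^T)], and the
   bracket is [S]. *)
have GSG : n.+1%:R^-1 *: (\sum_(k < n.+1) outer (p k)) = G *m Sigma *m G^T.
  have -> : n.+1%:R^-1 *: (\sum_(k < n.+1) outer (p k)) = Sigma + S.
    by rewrite /S addrC subrK.
  rewrite -ME /G linearD/= trmx1 trmx_mul Vsym Msym mulmxDl mul1mx.
  rewrite -(mulmxA M V Sigma) VS mulmx1 mulmxDr mulmx1 mulmxDl mulmxA.
  by rewrite SV mul1mx !mulmxA -!addrA.
have := RWP_uniform_on_le PnE H1 SH uG GSG.
have -> : (G - 1%:M) *m Sigma *m (G - 1%:M)^T = M *m V *m M^T.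
  rewrite /G addrAC subrr add0r trmx_mul Vsym -(mulmxA M V Sigma) VS mulmx1.
  by rewrite mulmxA.
move=> Rle.
have Rfin : RWP Pn H \is a fin_num.
  by rewrite ge0_fin_numE ?RWP_ge0// (le_lt_trans Rle) ?ltry.
have {}Rle : fine (RWP Pn H) <= \tr (M *m V *m M^T).
  by rewrite -lee_fin fineK.
apply: (@le_trans _ _ (r ^+ 2 *
    (4^-1 * \tr (S *m V *m S^T) + d%:R * c ^+ 2 * `|S| ^+ 3))).
  rewrite rr ler_wpM2l ?exprn_ge0 ?(ltW r0)//.
  apply: (le_trans Rle); exact: quadratic_mx_eq_trace.
have Ysym : Y^T = Y by rewrite YS linearZ/= SSsym.
rewrite RbarE -/V Ysym nY YS SSsym -!scalemxAl -scalemxAr !mxtraceZ.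
rewrite le_eqVlt; apply/orP; left; apply/eqP; field.
by rewrite gt_eqF.
Qed.

(** * Regularity of [Rbar] *)

Lemma sum_continuous (R : realType) (T : topologicalType) (I : Type)
    (s : seq I) (F : I -> T -> R) :
  (forall i, continuous (F i)) -> continuous (fun x => \sum_(i <- s) F i x).
Proof.
move=> cF; elim: s => [|i s ih] x.
  rewrite (_ : (fun _ => _) = cst 0); first exact: cvg_cst.
  by apply/funext => y; rewrite big_nil.
rewrite (_ : (fun _ => _) = F i \+ (fun x => \sum_(i <- s) F i x)).
  exact: (cvgD (cF i x) (ih x)).
by apply/funext => y; rewrite big_cons.
Qed.

(** As a polynomial in the entries, [Rbar] is visibly continuous and measurable. *)
Lemma Rbar_sumE (R : realType) (d : nat) (Sigma Z : 'M[R]_d) :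
  Rbar Sigma Z = \sum_(i < d) \sum_(k < d) \sum_(l < d)
    4^-1 * invmx Sigma l k * (Z l i * Z k i).
Proof.
rewrite RbarE /mxtrace mulr_sumr; apply: eq_bigr => i _.
rewrite mxE mulr_sumr; apply: eq_bigr => k _.
rewrite mxE mulr_suml mulr_sumr; apply: eq_bigr => l _.
by rewrite mxE; ring.
Qed.

Lemma Rbar_continuous (R : realType) (d : nat) (Sigma : 'M[R]_d) :
  continuous (fun Z : 'M[R]_d => Rbar Sigma Z).
Proof.
rewrite (_ : (fun Z => _) = fun Z : 'M[R]_d => \sum_(i < d) \sum_(k < d)
    \sum_(l < d) 4^-1 * invmx Sigma l k * (Z l i * Z k i)).
  2: by apply/funext => Z; exact: Rbar_sumE.
apply: (@sum_continuous R 'M[R]_d) => i; apply: (@sum_continuous R 'M[R]_d) => k.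
apply: (@sum_continuous R 'M[R]_d) => l Z.
apply: (@cvgM _ _ (nbhs Z)); first exact: cvg_cst.
by apply: cvgM; exact: coord_continuous.
Qed.

Lemma Rbar_measurable (R : realType) (d : nat) (Sigma : 'M[R]_d)
    (dT : measure_display) (T : measurableType dT) (Z : T -> 'M[R]_d) :
  (forall i j, measurable_fun setT (fun w => Z w i j)) ->
  measurable_fun setT (fun w => Rbar Sigma (Z w)).
Proof.
move=> mZ; under eq_fun do rewrite Rbar_sumE.
apply: measurable_sum => i; apply: measurable_sum => k; apply: measurable_sum => l.
by apply: measurable_funM => //; exact: measurable_funM.
Qed.

(** * Comparison of integrals and upper limits *)

(* The integral of a nonnegative function is a supremum over the simple functions
   below it, so no measurability is needed; this avoids proving that the profile
   function is measurable in the sample. *)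
Lemma le_integral_pointwise (R : realType) (dT : measure_display)
    (T : measurableType dT) (mu : {measure set T -> \bar R}) (f g : T -> \bar R) :
  (forall x, (f x <= g x)%E) -> (\int[mu]_x f x <= \int[mu]_x g x)%E.
Proof.
move=> fg.
have ge0_le (u v : T -> \bar R) : (forall x, 0 <= u x)%E ->
    (forall x, u x <= v x)%E -> (\int[mu]_x u x <= \int[mu]_x v x)%E.
  move=> u0 uv; have v0 x : (0 <= v x)%E by exact: le_trans (uv x).
  rewrite !ge0_integralTE//; apply: ereal_sup_le => _ [h hu <-].
  by exists h => // x; exact: le_trans (uv x).
rewrite integralE [leRHS]integralE; apply: leeB; apply: ge0_le => // x.
- by rewrite !funeposE ge_max !le_max fg lexx orbT.
- by rewrite !funenegE ge_max !le_max leeN2 fg lexx orbT.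
Qed.

(** Far enough out, each tail supremum of [u] is below that of [v], and the latter tend to [l]. *)
Lemma limn_esup_le_near_cvg (R : realType) (u v : nat -> \bar R) l :
  (\forall n \near \oo, u n <= v n)%E -> v @ \oo --> l ->
  (limn_esup u <= l)%E.
Proof.
move=> [N _ uv] /cvg_esups vl; apply: (cvge_ge _ vl).
exists N => // n Nn; rewrite /limn_esup limf_esupE.
apply: (@le_trans _ _ (ereal_sup [set u x | x in [set k | (n <= k)%N]])).
  by apply: ereal_inf_lbound; exists [set k | (n <= k)%N] => //; exists n.
apply: ge_ereal_sup => _ [k nk <-].
apply: (le_trans (uv k (leq_trans Nn nk))).
by apply: ereal_sup_ubound; exists k.
Qed.

(** * Test functions dominating the scaled profile *)

(** A substitute for the maximum norm whose continuity and measurability follow entry by entry. *)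
Definition entry_sum (R : realType) (d : nat) (y : 'M[R]_d) : R :=
  \sum_(i < d) \sum_(j < d) `|y i j|.

Lemma mx_norm_le_entry_sum (R : realType) (d : nat) (y : 'M[R]_d) :
  `|y| <= entry_sum y.
Proof.
have e0 i : 0 <= \sum_(j < d) `|y i j| by apply: sumr_ge0.
apply: mx_norm_leP => [|i j]; first exact: sumr_ge0.
rewrite /entry_sum (bigD1 i)//= (bigD1 j)//= -addrA lerDl addr_ge0//.
  exact: sumr_ge0.
exact: sumr_ge0.
Qed.

(* The last summand dominates the oscillation of [f] where [y] is too large for the local expansion. *)
Definition test_fun (R : realType) (d : nat) (f : R -> R) (B : R)
    (Sigma : 'M[R]_d) (m : nat) (y : 'M[R]_d) : R :=
  f (Rbar Sigma y + m.+1%:R^-1) +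
  2 * B * Num.min 1 (entry_sum y * m.+1%:R^-1).

Lemma test_fun_continuous (R : realType) (d : nat) (f : R -> R) B
    (Sigma : 'M[R]_d) m :
  continuous f -> continuous (test_fun f B Sigma m).
Proof.
move=> cf y; apply: (@cvgD _ _ _ (nbhs y)).
  apply: continuous_cvg; first exact: cf.
  by apply: (@cvgD _ _ _ (nbhs y)); [exact: Rbar_continuous|exact: cvg_cst].
apply: (@cvgM _ _ (nbhs y)); first exact: cvg_cst.
apply: (@continuous_min R 'M[R]_d (cst 1) (fun y => entry_sum y * m.+1%:R^-1)).
  exact: (@cvg_cst _ (1 : R) _ (nbhs y)).
apply: (@cvgM _ _ (nbhs y)); last exact: cvg_cst.
apply: (@sum_continuous R 'M[R]_d) => i; apply: (@sum_continuous R 'M[R]_d) => j.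
move=> {}y; apply: (@cvg_norm _ _ _ (nbhs y)); exact: coord_continuous.
Qed.

Lemma entry_sum_ge0 (R : realType) (d : nat) (y : 'M[R]_d) : 0 <= entry_sum y.
Proof. by apply: sumr_ge0 => i _; exact: sumr_ge0. Qed.

Lemma test_fun_bounded (R : realType) (d : nat) (f : R -> R) B
    (Sigma : 'M[R]_d) m y :
  (forall x, `|f x| <= B) -> `|test_fun f B Sigma m y| <= 3 * B.
Proof.
move=> fB; have B0 : 0 <= B := le_trans (normr_ge0 _) (fB 0).
have chi0 : 0 <= Num.min 1 (entry_sum y * m.+1%:R^-1).
  by rewrite le_min ler01/= mulr_ge0// entry_sum_ge0.
have chi1 : Num.min 1 (entry_sum y * m.+1%:R^-1) <= 1 by rewrite ge_min lexx.
rewrite /test_fun (le_trans (ler_normD _ _))//.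
have := fB (Rbar Sigma y + m.+1%:R^-1).
rewrite [X in _ -> _ + X <= _]ger0_norm ?mulr_ge0//.
nra.
Qed.

Lemma test_fun_measurable (R : realType) (d : nat) (f : R -> R) B
    (Sigma : 'M[R]_d) m (dT : measure_display) (T : measurableType dT)
    (Z : T -> 'M[R]_d) :
  continuous f -> (forall i j, measurable_fun setT (fun w => Z w i j)) ->
  measurable_fun setT (fun w => test_fun f B Sigma m (Z w)).
Proof.
move=> cf mZ; apply: measurable_funD.
  apply: (@measurableT_comp _ _ _ _ _ _ f).
    exact: continuous_measurable_fun.
  by apply: measurable_funD => //; exact: Rbar_measurable.
apply: measurable_funM => //; apply: measurable_minr => //.
apply: measurable_funM => //; do 2 (apply: measurable_sum => ?).
by apply: measurableT_comp.
Qed.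

Lemma test_fun_cvg (R : realType) (d : nat) (f : R -> R) B
    (Sigma : 'M[R]_d) y : continuous f ->
  (fun m => test_fun f B Sigma m y) @ \oo --> f (Rbar Sigma y).
Proof.
move=> cf; rewrite -[f _]addr0; apply: cvgD.
  apply: continuous_cvg; first exact: cf.
  rewrite -[X in _ --> X]addr0; apply: cvgD; first exact: cvg_cst.
  exact: cvg_harmonic.
rewrite -(mulr0 (2 * B)); apply: cvgM; first exact: cvg_cst.
have e0 : (fun m : nat => entry_sum y * m.+1%:R^-1) @ \oo --> (0 : R).
  rewrite -(mulr0 (entry_sum y)); apply: cvgM; first exact: cvg_cst.
  exact: cvg_harmonic.
apply: (squeeze_cvgr _ (cvg_cst (0 : R)) e0).
apply: nearW => m; rewrite le_min ler01 ge_min lexx orbT/= andbT.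
by rewrite mulr_ge0// entry_sum_ge0.
Qed.

(** This is the growth condition of the central limit property; the added 1 keeps the constant
    positive when [d = 0]. *)
Lemma outer_linear_growth (R : realType) (d : nat) (x : @Vec R d) :
  \sum_(i < d) \sum_(j < d) `|outer x i j| <=
    (d%:R ^+ 2 + 1) * (1 + sqnorm x).
Proof.
apply: (@le_trans _ _ (\sum_(i < d) \sum_(j < d) sqnorm x)).
  by do 2 (apply: ler_sum => ? _); exact: outer_le_sqnorm.
have x0 := sqnorm_ge0 x; have d0 : 0 <= d%:R ^+ 2 :> R by exact: exprn_ge0.
rewrite !sumr_const !card_ord -mulrnA -[leLHS]mulr_natl natrM -expr2.
nra.
Qed.

Lemma test_fun_integral_cvg (R : realType) (d : nat) (f : R -> R) B
    (Sigma : 'M[R]_d) (dT : measure_display) (T : measurableType dT)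
    (Q : probability T R) (Z : T -> 'M[R]_d) :
  continuous f -> (forall x, `|f x| <= B) ->
  (forall i j, measurable_fun setT (fun w => Z w i j)) ->
  (fun m : nat => \int[Q]_w (test_fun f B Sigma m (Z w))%:E)%E @ \oo -->
    (\int[Q]_w (f (Rbar Sigma (Z w)))%:E)%E.
Proof.
move=> cf fB mZ.
apply: (@dominated_cvg _ _ _ _ _ measurableT
  (fun m w => (test_fun f B Sigma m (Z w))%:E) _ (cst (3 * B)%:E)) => //.
- by move=> m; apply/measurable_EFinP; exact: test_fun_measurable.
- by move=> w _; apply: cvg_EFin; [exact: nearW|exact: test_fun_cvg].
- exact: finite_measure_integrable_cst.
- by move=> m w _; rewrite lee_fin; exact: test_fun_bounded.
Qed.

(** The threshold on [n] is uniform in [w]: a large deviation is absorbed by the cutoff term, and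
    otherwise the cubic remainder drops below [m.+1%:R^-1]. *)
Lemma scaled_RWP_le_test_fun (R : realType) (d : nat) (f : R -> R) B
    (H Sigma : 'M[R]_d) (dO : measure_display) (Omega : measurableType dO)
    (X : R -> Omega -> @Vec R d) (m : nat) :
  (forall x, `|f x| <= B) -> {homo f : x y / x <= y} ->
  (forall i, H i i = 1) -> (forall i j, i != j -> (Sigma *m H) i j = 0) ->
  Sigma^T = Sigma -> Sigma \in unitmx ->
  \forall n \near \oo, forall w,
    f (n%:R * fine (RWP (empirical X n w) H)) <=
    test_fun f B Sigma m (Num.sqrt n%:R *:
      (n%:R^-1 *: \sum_(1 <= t < n.+1) outer (X t%:R w) - Sigma)).
Proof.
move=> fB fmono H1 SH Ssym uS.
pose c : R := 1 + d%:R ^+ 2 * `|invmx Sigma|.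
have c1 : 1 <= c by rewrite lerDl mulr_ge0// exprn_ge0.
pose a : R := m.+1%:R.
have a0 : 0 < a by rewrite ltr0n.
(* The first summand secures the smallness of the deviation, the second makes a remainder of size
   [d%:R * c ^+ 2 * a ^+ 3] over the root of [n] at most [a^-1]. *)
pose K := 2 * c * a + d%:R * c ^+ 2 * a ^+ 4.
have dc0 : 0 <= d%:R * c ^+ 2 by rewrite mulr_ge0// sqr_ge0.
have K0 : 0 <= K.
  by rewrite addr_ge0// mulr_ge0 ?exprn_ge0 ?(ltW a0)// mulr_ge0//; lra.
have [N _ NK] := nbhs_infty_ger (K ^+ 2).
exists N.+1 => // -[|n] //= Nn w.
have {NK} Kr : K <= Num.sqrt n.+1%:R.
  rewrite -(ger0_norm K0) -sqrtr_sqr ler_wsqrtr//; exact/NK/ltnW.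
rewrite big_add1/= big_mkord.
set Y := _ *: _; set r := Num.sqrt _ in Kr Y *.
have r0 : 0 < r by rewrite sqrtr_gt0.
have B0 : 0 <= B := le_trans (normr_ge0 _) (fB 0).
rewrite /test_fun -/a.
(* For large [Y] the cutoff equals 1, and [2 * B] covers the difference of any two values of [f]. *)
have [Ylarge|Ysmall] := leP a (entry_sum Y).
  rewrite (_ : Num.min _ _ = 1); last by rewrite min_l// ler_pdivlMr// mul1r.
  have := fB (n.+1%:R * fine (RWP (empirical X n.+1 w) H)).
  have := fB (Rbar Sigma Y + a^-1).
  by rewrite !ler_norml => /andP[? ?] /andP[? ?]; lra.
have Ya : `|Y| <= a := le_trans (mx_norm_le_entry_sum Y) (ltW Ysmall).
rewrite (@le_trans _ _ (f (Rbar Sigma Y + a^-1)))//; last first.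
  rewrite lerDl mulr_ge0// ?mulr_ge0// le_min ler01/= mulr_ge0 ?entry_sum_ge0//.
  by rewrite invr_ge0 ltW.
apply: fmono.
have cY : 2 * c * `|Y| <= r.
  apply: (le_trans _ Kr); rewrite /K -[leLHS]addr0 lerD//.
    by rewrite ler_wpM2l// mulr_ge0//; lra.
  by rewrite mulr_ge0// exprn_ge0// ltW.
apply: (le_trans (scaled_RWP_uniform_on_le
  (empirical_uniform_on X n w) H1 SH Ssym uS cY)).
rewrite lerD2l ler_pdivrMr// -/c ler_pdivlMl//.
apply: (le_trans _ Kr); rewrite /K -[leLHS]add0r lerD//.
  by rewrite mulr_ge0 ?(ltW a0)// mulr_ge0//; lra.
rewrite mulrCA ler_wpM2l// [leRHS]exprS ler_wpM2l ?(ltW a0)//.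
by rewrite lerXn2r ?nnegrE ?(ltW a0).
Qed.

(** * Passage to the limit *)

Unset Implicit Arguments.

Theorem theorem2 (R : realType) (d : nat)
    (dO : measure_display) (Omega : measurableType dO) (P : probability Omega R)
    (X : R -> Omega -> @Vec R d) (Pstar : probability (@Vec R d) R)
    (Hstar : 'M[R]_d) :
  (* X(t) are random vectors with common law P* *)
  (forall t, 0 <= t -> measurable_fun setT (X t)) ->
  (forall t, 0 <= t -> forall A : set (@Vec R d), measurable A ->
     P (X t @^-1` A) = Pstar A) ->
  (* stationary and ergodic *)
  stationary P X ->
  ergodic P X ->
  (* E ||X||_2^4 < oo *)
  (\int[Pstar]_x ((sqnorm x) ^+ 2)%:E < +oo)%E ->
  (* each X(t) has a density *)
  has_density Pstar ->
  (* central limit property *)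
  clt_property P X Pstar ->
  (* Sigma_* invertible *)
  Emat Pstar outer \in unitmx ->
  (* Hstar is the unique solution of min E[X^T H H^T X] s.t. diag(H) = 1 *)
  (forall i, Hstar i i = 1) ->
  (forall H : 'M[R]_d, (forall i, H i i = 1) ->
     (objective Pstar Hstar <= objective Pstar H)%E) ->
  (forall H : 'M[R]_d, (forall i, H i i = 1) ->
     (forall H' : 'M[R]_d, (forall i, H' i i = 1) ->
        (objective Pstar H <= objective Pstar H')%E) -> H = Hstar) ->
  (* conclusion: n R_n(Hstar) is asymptotically stochastically dominated by R-bar; Z ~ N(0, Ups_g), g(x) = x x^T *)
  forall Ups, cov_limit P X outer Ups ->
  forall (dO' : measure_display) (Omega' : measurableType dO')
         (Q : probability Omega' R) (Z : Omega' -> 'M[R]_d),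
  gaussian_mx Q Z Ups ->
  forall f : R -> R, continuous f -> (exists M, forall x, `|f x| <= M) ->
    {homo f : x y / x <= y} ->
    (limn_esup (fun n : nat =>
        \int[P]_w (f (n%:R * fine (RWP (empirical X n w) Hstar)))%:E)
     <= \int[Q]_w (f (Rbar (Emat Pstar outer) (Z w)))%:E)%E.

Proof.
move=> _ _ _ _ X4 _ clt uS H1 Hmin _ Ups covU dO' Omega' Q Z Zgauss f cf [B fB].
move=> fmono.
set Sigma := Emat Pstar outer in uS *.
have Ssym : Sigma^T = Sigma by exact: Emat_outer_sym.
have SH := objective_min_offdiag X4 H1 Hmin.
have [|||Ups' [covU' weak]] := clt outer (d%:R ^+ 2 + 1).
- exact: measurable_outer.
- by rewrite ltr_wpDl// exprn_ge0.
- exact: outer_linear_growth.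
(* The covariance supplied by the central limit property is the given one, by uniqueness of
   limits. *)
have UE : Ups' = Ups.
  apply/funext => i; apply/funext => j; apply/funext => k; apply/funext => l.
  suff: (Ups' i j k l)%:E = (Ups i j k l)%:E by case.
  exact: (cvg_unique (@ereal_hausdorff R) (covU' i j k l) (covU i j k l)).
rewrite UE in weak.
have mZ := Zgauss.1.
(* It suffices to bound the upper limit by the Gaussian integral of each test function: first [n]
   tends to infinity with [m] fixed, then [m] does. *)
apply: (cvge_ge _ (@test_fun_integral_cvg _ _ _ _ Sigma _ _ Q _ cf fB mZ)).
apply: nearW => m.
apply: limn_esup_le_near_cvg; last first.
  apply: (weak _ _ _ _ Zgauss); first exact: test_fun_continuous.
  by exists (3 * B) => y; exact: test_fun_bounded.
have := scaled_RWP_le_test_fun X m fB fmono H1 SH Ssym uS.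
apply: filterS => n le_n; apply: le_integral_pointwise => w.
by rewrite lee_fin; exact: le_n.
Qed.
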